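(* Let $U$ and $A$ be monoids, and let $A\times U\to U$, $(\alpha,u)\mapsto\alpha\cdot u$, and $A\times U\to A$, $(\alpha,u)\mapsto\alpha^u$, be functions (defined on all of $A\times U$) satisfying, for all $\alpha,\beta\in A$ and $u,v\in U$, $$(\alpha\beta)\cdot u=\alpha\cdot(\beta\cdot u),\quad (\alpha\beta)^u=\alpha^{\beta\cdot u}\beta^u,\quad \alpha\cdot(uv)=(\alpha\cdot u)(\alpha^u\cdot v),\quad \alpha^{uv}=(\alpha^u)^v,$$ $$\alpha^{1}=\alpha,\quad 1\cdot u=u,\quad \alpha\cdot 1=1,\quad 1^u=1.$$ Put on $U\times A$ the monoid multiplication $(u,\alpha)(v,\beta)=(u(\alpha\cdot v),\ \alpha^v\beta)$. If the monoids $U$ and $A$ have (monoid) presentations $\langle X\mid R\rangle$ and $\langle Y\mid T\rangle$, respectively, with $X\cap Y=\emptyset$, then a monoid presentation for $U\times A$ is $$\langle X\cup Y\mid R\cup T\cup W\rangle$$ in which $W$ consists of all pairs $(\alpha u,\ (\alpha\cdot u)(\alpha^u))$ for $(\alpha,u)\in A\times U$. (The generator $x\in X$ corresponds to $(x,1)$ and $y\in Y$ to $(1,y)$.)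
   Context: A monoid presentation $\langle X\mid R\rangle$ consists of a set $X$ and a binary relation $R$ on the free monoid $X^*$ of words in $X$; it presents the quotient of $X^*$ by the congruence generated by $R$. In the pairs of $W$, elements of $A$ and $U$ are written as words in $Y$ and $X$, respectively, representing them (the choice of representing words does not matter modulo $R\cup T$). *)

(* Defs.v *)
From HB Require Import structures.
From mathcomp Require Import all_boot.
From mathcomp Require Import boolp.

Set Implicit Arguments.
Unset Strict Implicit.
Unset Printing Implicit Defensive.

Import Algebra.

Local Open Scope group_scope.
Local Open Scope quotient_scope.

(* The free monoid on X is [seq X], under concatenation. *)
Inductive gen_cong (X : Type) (R : seq X -> seq X -> Prop) :
    seq X -> seq X -> Prop :=
| gen_cong_rel p q : R p q -> gen_cong R p q
| gen_cong_refl p : gen_cong R p p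
| gen_cong_sym p q : gen_cong R p q -> gen_cong R q p
| gen_cong_trans p q r : gen_cong R p q -> gen_cong R q r -> gen_cong R p r
| gen_cong_cat p q p' q' :
    gen_cong R p q -> gen_cong R p' q' -> gen_cong R (p ++ p') (q ++ q').

Section PresentedMonoid.
Variables (X : choiceType) (R : seq X -> seq X -> Prop).

Definition gen_congb : rel (seq X) := fun p q => `[< gen_cong R p q >].

Fact gen_congb_refl : reflexive gen_congb.
Proof. by move=> p; apply/asboolP; apply: gen_cong_refl. Qed.

Fact gen_congb_sym : symmetric gen_congb.
Proof. by move=> p q; apply/asboolP/asboolP; apply: gen_cong_sym. Qed.

Fact gen_congb_trans : transitive gen_congb.
Proof.
by move=> q p r /asboolP pq /asboolP qr; apply/asboolP/(gen_cong_trans pq).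
Qed.

Canonical gen_cong_equiv :=
  EquivRel gen_congb gen_congb_refl gen_congb_sym gen_congb_trans.

Definition pres := {eq_quot gen_cong_equiv}.
HB.instance Definition _ := Choice.on pres.

Lemma pres_eqP (p q : seq X) : \pi_pres p = \pi_pres q <-> gen_cong R p q.
Proof. by split=> [/eqmodP/asboolP|pq]; last exact/eqmodP/asboolP. Qed.

Definition pres_mul (a b : pres) : pres := \pi_pres (repr a ++ repr b).
Definition pres_one : pres := \pi_pres [::].

Lemma pres_mulE (p q : seq X) :
  pres_mul (\pi_pres p) (\pi_pres q) = \pi_pres (p ++ q).
Proof. by apply/pres_eqP/gen_cong_cat; apply/pres_eqP; rewrite reprK. Qed.

Lemma pres_ind (P : pres -> Prop) :
  (forall p : seq X, P (\pi_pres p)) -> forall a, P a.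
Proof. by move=> Ppi a; rewrite -[a]reprK. Qed.

Fact pres_mulA : associative pres_mul.
Proof.
move=> a b c; elim/pres_ind: a => p; elim/pres_ind: b => q.
by elim/pres_ind: c => r; rewrite !pres_mulE catA.
Qed.

Fact pres_mul1 : left_id pres_one pres_mul.
Proof. by elim/pres_ind=> p; rewrite pres_mulE. Qed.

Fact pres_mulr1 : right_id pres_one pres_mul.
Proof. by elim/pres_ind=> p; rewrite pres_mulE cats0. Qed.

HB.instance Definition _ := isMonoid.Build pres pres_mulA pres_mul1 pres_mulr1.

Definition pres_gen (x : X) : pres := \pi_pres [:: x].

(* The monoid M is presented by <X | R>, each generator x corresponding to the
   element g x of M. *)
Definition is_presentation (M : monoidType) (g : X -> M) : Prop :=
  exists phi : pres -> M,
    [/\ monoid_morphism phi, bijective phi & forall x, phi (pres_gen x) = g x].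

End PresentedMonoid.

Definition word_val (X : Type) (M : monoidType) (g : X -> M) (w : seq X) : M :=
  \prod_(x <- w) g x.

(* Zappa-Szep products: [lact a u] is alpha . u and [ract a u] is alpha ^ u. *)

Record zs_action (U A : monoidType) := ZSAction {
  lact : A -> U -> U;
  ract : A -> U -> A;
  lactMl : forall a b u, lact (a * b) u = lact a (lact b u);
  ractMl : forall a b u, ract (a * b) u = ract a (lact b u) * ract b u;
  lactMr : forall a u v, lact a (u * v) = lact a u * lact (ract a u) v;
  ractMr : forall a u v, ract a (u * v) = ract (ract a u) v;
  ract1r : forall a, ract a 1 = a;
  lact1l : forall u, lact 1 u = u;
  lact1r : forall a, lact a 1 = 1;
  ract1l : forall u, ract 1 u = 1
}.

(* An alias, because [U * A] itself carries the componentwise product. *)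
Definition zs_prod (U A : monoidType) (S : zs_action U A) : Type :=
  (U * A)%type.

Section ZSProd.
Variables (U A : monoidType) (S : zs_action U A).

HB.instance Definition _ := Choice.copy (zs_prod S) (U * A)%type.

Definition zs_mul (p q : zs_prod S) : zs_prod S :=
  (p.1 * lact S p.2 q.1, ract S p.2 q.1 * q.2).
Definition zs_one : zs_prod S := (1, 1).

Fact zs_mulA : associative zs_mul.
Proof.
move=> [u a] [v b] [w c]; rewrite /zs_mul /=.
by rewrite lactMr lactMl ractMr ractMl !mulgA.
Qed.

Fact zs_mul1 : left_id zs_one zs_mul.
Proof. by move=> [u a]; rewrite /zs_mul /= lact1l ract1l !mul1g. Qed.

Fact zs_mulr1 : right_id zs_one zs_mul.
Proof. by move=> [u a]; rewrite /zs_mul /= lact1r ract1r !mulg1. Qed.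

HB.instance Definition _ := isMonoid.Build (zs_prod S) zs_mulA zs_mul1 zs_mulr1.

Variables (X Y : Type).

(* The disjoint union of X and Y is the sum type X + Y. *)
Definition zs_gen (gX : X -> U) (gY : Y -> A) (z : X + Y) : zs_prod S :=
  match z with
  | inl x => (gX x, 1)
  | inr y => (1, gY y)
  end.

Definition wordl (w : seq X) : seq (X + Y) := map inl w.
Definition wordr (w : seq Y) : seq (X + Y) := map inr w.

(* R, T and W; [rU u] and [rA a] are the words chosen to represent u and a. *)
Inductive zs_rel (R : seq X -> seq X -> Prop) (T : seq Y -> seq Y -> Prop)
    (rU : U -> seq X) (rA : A -> seq Y) :
    seq (X + Y) -> seq (X + Y) -> Prop :=
| zs_rel_R p q : R p q -> zs_rel R T rU rA (wordl p) (wordl q)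
| zs_rel_T p q : T p q -> zs_rel R T rU rA (wordr p) (wordr q)
| zs_rel_W (a : A) (u : U) :
    zs_rel R T rU rA (wordr (rA a) ++ wordl (rU u))
                     (wordl (rU (lact S a u)) ++ wordr (rA (ract S a u))).

End ZSProd.

(* Main.v *)
(* Every word over X + Y is congruent to the word of a pair (u, a) of U x A,
   since W moves letters of Y to the right of letters of X; the pair is the value
   of the word, so words with equal values are congruent. *)
Require Import Defs.
From HB Require Import structures.
From mathcomp Require Import all_boot.
From mathcomp Require Import boolp.

Set Implicit Arguments.
Unset Strict Implicit.
Unset Printing Implicit Defensive.

Import Algebra.

Local Open Scope group_scope.
Local Open Scope quotient_scope.

(** Used with [inl] and [inr], to carry a derivation over one alphabet into the disjoint union. *)
Lemma gen_cong_map (X Z : Type) (f : X -> Z) (R : seq X -> seq X -> Prop)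
    (Q : seq Z -> seq Z -> Prop) p q :
  (forall p q, R p q -> Q (map f p) (map f q)) ->
  gen_cong R p q -> gen_cong Q (map f p) (map f q).
Proof.
move=> RQ; elim=> {p q} [p q /RQ|p|p q _|p q r _ pq _|p q p' q' _ pq _ pq'].
- exact: gen_cong_rel.
- exact: gen_cong_refl.
- exact: gen_cong_sym.
- exact: gen_cong_trans.
- by rewrite !map_cat; apply: gen_cong_cat.
Qed.

Section WordVal.
Variables (X : Type) (M : monoidType) (g : X -> M).

Lemma word_val_nil : word_val g [::] = 1.
Proof. exact: big_nil. Qed.

Lemma word_val_cons x w : word_val g (x :: w) = g x * word_val g w.
Proof. exact: big_cons. Qed.

Lemma word_val_cat p q : word_val g (p ++ q) = word_val g p * word_val g q.
Proof. exact: big_cat. Qed.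

Lemma gen_cong_word_val (R : seq X -> seq X -> Prop) p q :
  (forall p q, R p q -> word_val g p = word_val g q) ->
  gen_cong R p q -> word_val g p = word_val g q.
Proof.
move=> Rg; elim=> {p q} [p q /Rg||p q _ ->|p q r _ -> _ ->|] //.
by move=> p q p' q' _ e _ e'; rewrite !word_val_cat e e'.
Qed.

End WordVal.

(** A morphism from the quotient is determined on generators, so it must be evaluation of words. Its
    surjectivity is the first condition; its being well defined and injective is the second. All
    later work is thus on words, not classes. *)
Lemma is_presentationP (X : choiceType) (R : seq X -> seq X -> Prop)
    (M : monoidType) (g : X -> M) :
  is_presentation R g <->
  (forall m, exists w, word_val g w = m) /\
  (forall p q, gen_cong R p q <-> word_val g p = word_val g q).
Proof.
split=> [[phi [[phi1 phiM] phi_bij phig]]|[surj congP]].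
  have phiE w : phi (\pi_(pres R) w) = word_val g w.
    elim: w => [|x w IHw]; first by rewrite word_val_nil -phi1.
    by rewrite word_val_cons -IHw -phig -phiM; congr phi; exact/esym/pres_mulE.
  split=> [m|p q].
    case: phi_bij => psi _ psiK; exists (repr (psi m)).
    by rewrite -phiE reprK psiK.
  rewrite -!phiE -pres_eqP; split=> [->//|].
  exact: bij_inj.
(* A chosen word [r m] of value [m] gives the inverse map: [m] goes to the class of [r m]. *)
have [r rK] := choice surj.
(* [repr] returns some word of the class, not [w] itself; [congP] makes evaluation independent of
   this choice. *)
have phiE w : word_val g (repr (\pi_(pres R) w)) = word_val g w.
  by apply/congP/pres_eqP; rewrite reprK.
exists (fun a : pres R => word_val g (repr a)); split.
- split=> [|a b]; first by rewrite phiE word_val_nil.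
  by rewrite phiE word_val_cat.
- exists (fun m => \pi_(pres R) (r m)) => [a|m]; last by rewrite phiE.
  by rewrite -[RHS]reprK; apply/pres_eqP/congP; rewrite rK.
- by move=> x; rewrite phiE word_val_cons word_val_nil mulg1.
Qed.

Section ZSPresentation.
Variables (U A : monoidType) (S : zs_action U A) (X Y : choiceType).
Variables (gX : X -> U) (gY : Y -> A).

Lemma zs_prodE (p q : zs_prod S) :
  p * q = (p.1 * lact S p.2 q.1, ract S p.2 q.1 * q.2).
Proof. by []. Qed.

Lemma word_val_wordl (w : seq X) :
  word_val (zs_gen S gX gY) (wordl Y w) = (word_val gX w, 1).
Proof.
elim: w => [|x w IHw]; first by rewrite !word_val_nil.
rewrite [LHS]word_val_cons IHw word_val_cons.
by rewrite zs_prodE /= lact1l ract1l mulg1.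
Qed.

Lemma word_val_wordr (w : seq Y) :
  word_val (zs_gen S gX gY) (wordr X w) = (1, word_val gY w).
Proof.
elim: w => [|y w IHw]; first by rewrite !word_val_nil.
rewrite [LHS]word_val_cons IHw word_val_cons.
by rewrite zs_prodE /= lact1r ract1r mulg1.
Qed.

Variables (R : seq X -> seq X -> Prop) (T : seq Y -> seq Y -> Prop).
Variables (rU : U -> seq X) (rA : A -> seq Y).
Hypothesis congR : forall p q, gen_cong R p q <-> word_val gX p = word_val gX q.
Hypothesis congT : forall p q, gen_cong T p q <-> word_val gY p = word_val gY q.
Hypothesis rUP : forall u, word_val gX (rU u) = u.
Hypothesis rAP : forall a, word_val gY (rA a) = a.

Local Notation Q := (zs_rel S R T rU rA).
Local Notation g := (zs_gen S gX gY).

(** The normal form of a pair, resting on the factorization (u, a) = (u, 1)(1, a). *)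
Definition zs_word (p : zs_prod S) : seq (X + Y) :=
  wordl Y (rU p.1) ++ wordr X (rA p.2).

Lemma word_val_zs_word p : word_val g (zs_word p) = p.
Proof.
case: p => u a; rewrite word_val_cat word_val_wordl word_val_wordr rUP rAP.
by rewrite zs_prodE /= lact1r ract1r mulg1 mul1g.
Qed.

Lemma gen_cong_wordl p q :
  word_val gX p = word_val gX q -> gen_cong Q (wordl Y p) (wordl Y q).
Proof. by move/congR; apply: gen_cong_map => {}p {}q; apply: zs_rel_R. Qed.

Lemma gen_cong_wordr p q :
  word_val gY p = word_val gY q -> gen_cong Q (wordr X p) (wordr X q).
Proof. by move/congT; apply: gen_cong_map => {}p {}q; apply: zs_rel_T. Qed.

(** Both embeddings of the factors are multiplicative, which settles [R] and [T]. For [W], the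
    product (1, a)(u, 1) is exactly the pair of [lact S a u] and [ract S a u]. *)
Lemma zs_rel_word_val p q : Q p q -> word_val g p = word_val g q.
Proof.
case=> {p q} [p q pq|p q pq|a u].
- by rewrite !word_val_wordl; congr pair; apply/congR/gen_cong_rel.
- by rewrite !word_val_wordr; congr pair; apply/congT/gen_cong_rel.
- rewrite [RHS](word_val_zs_word (lact S a u, ract S a u)) word_val_cat.
  by rewrite word_val_wordl word_val_wordr rUP rAP zs_prodE /= mul1g mulg1.
Qed.

(** Induction on [w]: a letter put in front of a normal form can be absorbed into it. *)
Lemma gen_cong_zs_word w : gen_cong Q w (zs_word (word_val g w)).
Proof.
elim: w => [|z w IHw].
  (* The words [rU 1] and [rA 1] may be nonempty, so they have to be reduced to the empty word by
     [R] and [T]. *)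
  rewrite word_val_nil /zs_word -[[::]]/(wordl Y [::] ++ wordr X [::]).
  by apply: gen_cong_cat; [apply: gen_cong_wordl | apply: gen_cong_wordr];
    rewrite ?rUP ?rAP word_val_nil.
apply: gen_cong_trans (gen_cong_cat (gen_cong_refl _ [:: z]) IHw) _.
rewrite word_val_cons; case: (word_val g w) => u a {w IHw}.
rewrite zs_prodE; case: z => [x|y]; rewrite /zs_word /=.
  (* A letter of [X] only lengthens the [X]-part, and 1 acts trivially, so the [Y]-part is
     unchanged. *)
  rewrite lact1l ract1l mul1g; apply: (@gen_cong_cat _ _ (wordl Y (x :: rU u)));
    last exact: gen_cong_refl.
  by apply: gen_cong_wordl; rewrite word_val_cons !rUP.
(* [W] applies only to chosen words, so the letter [y] is first replaced by the word chosen for its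
   value. *)
have yE : gen_cong Q (wordr X [:: y]) (wordr X (rA (gY y))).
  by apply: gen_cong_wordr; rewrite word_val_cons word_val_nil mulg1 rAP.
apply: gen_cong_trans (gen_cong_cat yE (gen_cong_refl _ _)) _.
rewrite mul1g catA.
apply: gen_cong_trans (gen_cong_cat (gen_cong_rel (zs_rel_W _ _ _ _ _ _ _))
  (gen_cong_refl _ _)) _.
(* After the exchange by [W] the [X]-parts agree; the two adjacent [Y]-words are merged into one
   chosen word by [T]. *)
rewrite -catA; apply: gen_cong_cat (gen_cong_refl _ _) _.
rewrite /wordr -map_cat; apply: gen_cong_wordr.
by rewrite word_val_cat !rAP.
Qed.

End ZSPresentation.

Theorem lemma3p16 (U A : monoidType) (S : zs_action U A)
    (X Y : choiceType)
    (R : seq X -> seq X -> Prop) (T : seq Y -> seq Y -> Prop)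
    (gX : X -> U) (gY : Y -> A)
    (presU : is_presentation R gX) (presA : is_presentation T gY)
    (rU : U -> seq X) (rA : A -> seq Y)
    (rUP : forall u : U, word_val gX (rU u) = u)
    (rAP : forall a : A, word_val gY (rA a) = a) :
  is_presentation (zs_rel S R T rU rA) (zs_gen S gX gY).
Proof.
have [_ congR] := (is_presentationP R gX).1 presU.
have [_ congT] := (is_presentationP T gY).1 presA.
apply/is_presentationP; split=> [m|p q].
  by exists (zs_word rU rA m); apply: word_val_zs_word.
split=> [|pq]; first exact/gen_cong_word_val/zs_rel_word_val.
apply: gen_cong_trans (gen_cong_zs_word S congR congT rUP rAP p) _.
by rewrite pq; apply/gen_cong_sym/gen_cong_zs_word.
Qed.
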